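(* Let $A$ be a unital $C^*$-algebra and let $a\in A$ be such that $a^{\dag}$ exists. Suppose that there exist $b,c\in A$ such that $a=bc$, $b^{-1}(0)=0$ and $cA=A$. Then the following statements are equivalent: (i) $a$ is EP; (ii) $a\in c^*A\cap Ab^*$; (iii) $(b^* )^{-1}(0)=c^{-1}(0)$; (iv) $bA=c^*A$; (v) $b_{-1}(0)=(c^* )_{-1}(0)$; (vi) $Ac=Ab^*$; (vii) $bA^{-1}=c^*A^{-1}$; (viii) $A^{-1}c=A^{-1}b^*$; (ix) there exists $x\in A^{-1}$ such that $c=xb^*$; (x) there exists $y\in A$ such that $y^{-1}(0)=0$ and $c=yb^*$; (xi) there exist $z_1,z_2\in A$ such that $c=z_1b^*$ and $b^*=z_2c$; (xii) there exists $v\in A$ such that $vA=A$ and $b=c^*v$; (xiii) there exists $s_1\in A$ such that $s_1^{-1}(0)=0$ and $b^*=s_1c$; (xiv) there exists $s_2\in A$ such that $s_2A=A$ and $c^*=bs_2$.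
   Context: $A^{-1}$ is the set of invertible elements of $A$. For $x\in A$: $x^{-1}(0)=\{y\in A: xy=0\}$, $x_{-1}(0)=\{y\in A: yx=0\}$, $xA=\{xy:y\in A\}$, $Ax=\{yx:y\in A\}$; also $xA^{-1}=\{xy:y\in A^{-1}\}$ and $A^{-1}x=\{yx:y\in A^{-1}\}$. The Moore-Penrose inverse of $a\in A$, if it exists, is the (unique) $x\in A$ with $a=axa$, $x=xax$ and $ax$, $xa$ self-adjoint; it is denoted $a^{\dag}$. An element $a$ is EP if $a^{\dag}$ exists and $aa^{\dag}=a^{\dag}a$. *)

(* Defs.v *)
From HB Require Import structures.
From mathcomp Require Import all_boot all_order all_algebra.
From mathcomp Require Import complex.
From mathcomp Require Import all_classical all_reals topology normedtype.

Set Implicit Arguments.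
Unset Strict Implicit.
Unset Printing Implicit Defensive.

Import Order.TTheory GRing.Theory Num.Theory.
Local Open Scope classical_set_scope.
Local Open Scope ring_scope.

(* Multiplication is part of this mixin, rather than inherited from algType,
   because Hierarchy Builder rejects a common substructure of normed modules
   over K and rings: Num.NumDomain is already such a join, with K the ring
   itself. The ring structure is recovered below. The norm is R[i]-valued; the
   order of R[i] makes its values nonnegative reals. The zero algebra is
   allowed. *)
HB.mixin Record isCStarAlgebra (R : realType) A
    & CompleteNormedModule R[i] A := {
  cstar_one : A;
  cstar_mul : A -> A -> A;
  star : A -> A;
  cstar_mulA : associative cstar_mul;
  cstar_mul1l : left_id cstar_one cstar_mul;
  cstar_mul1r : right_id cstar_one cstar_mul;
  cstar_mulDl : left_distributive cstar_mul +%R;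
  cstar_mulDr : right_distributive cstar_mul +%R;
  cstar_scaleAl : forall (k : R[i]) (x y : A),
    k *: cstar_mul x y = cstar_mul (k *: x) y;
  cstar_scaleAr : forall (k : R[i]) (x y : A),
    k *: cstar_mul x y = cstar_mul x (k *: y);
  cstar_normM : forall x y : A, `|cstar_mul x y| <= `|x| * `|y|;
  starK : involutive star;
  starD : {morph star : x y / x + y};
  starZ : forall (k : R[i]) (x : A), star (k *: x) = k^* *: star x;
  cstar_starM : forall x y : A,
    star (cstar_mul x y) = cstar_mul (star y) (star x);
  cstar_identity : forall x : A, `|cstar_mul (star x) x| = `|x| ^+ 2
}.

#[short(type="cstarAlgType")]
HB.structure Definition CStarAlgebra (R : realType) :=
  {A of CompleteNormedModule R[i] A & isCStarAlgebra R A}.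

HB.instance Definition _ (R : realType) (A : cstarAlgType R) :=
  GRing.Zmodule_isPzRing.Build (CStarAlgebra.sort A)
    (@cstar_mulA R A) (@cstar_mul1l R A) (@cstar_mul1r R A)
    (@cstar_mulDl R A) (@cstar_mulDr R A).

Lemma starM (R : realType) (A : cstarAlgType R) (x y : A) :
  star (x * y) = star y * star x.
Proof. exact: cstar_starM. Qed.

Section CStarDefs.
Variables (R : realType) (A : cstarAlgType R).
Implicit Types (x y a : A) (S : set A).

Definition invertibles : set A := [set y | exists z, y * z = 1 /\ z * y = 1].

(* x^{-1}(0) *)
Definition rann x : set A := [set y | x * y = 0].

(* x_{-1}(0) *)
Definition lann x : set A := [set y | y * x = 0].

(* xS and Sx; used with S = A and S = A^{-1} *)
Definition mulset_l x S : set A := [set x * y | y in S].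
Definition mulset_r S x : set A := [set y * x | y in S].

Definition self_adjoint x := star x = x.

Definition is_mp_inverse a x :=
  [/\ a = a * x * a, x = x * a * x, self_adjoint (a * x)
    & self_adjoint (x * a)].

Definition mp_invertible a := exists x, is_mp_inverse a x.

Lemma is_mp_inverse_unique a x y :
  is_mp_inverse a x -> is_mp_inverse a y -> x = y.
Proof.
move=> [ax xa sax sxa] [ay ya say sya].
have e1 : a * x = a * y.
  rewrite -sax {1}ay -!mulrA mulrA starM sax say.
  by rewrite mulrA -ax.
have e2 : x * a = y * a.
  rewrite -sxa {1}ay !mulrA -mulrA starM sxa sya.
  by rewrite -mulrA (mulrA a) -ax.
by rewrite xa -mulrA e1 mulrA e2 -ya.
Qed.

(* Equal to 0, by convention, when a has no Moore-Penrose inverse *)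
Definition mp_inverse a : A := xget 0 [set x | is_mp_inverse a x].

Definition EP a := mp_invertible a /\ a * mp_inverse a = mp_inverse a * a.

End CStarDefs.

Arguments invertibles {R} A.

(* Main.v *)
(* Write x for the Moore-Penrose inverse of a = bc. Cancelling in
   bc x bc = bc gives c x b = 1, so beta = c x and gamma = x b are
   Moore-Penrose inverses of b and c, and p = b beta = a x and
   q = gamma c = x a are the self-adjoint projections with pA = bA, Ap = Ab^*
   and qA = c^*A, Aq = Ac. Hence a is EP iff p = q, and each of the other
   conditions amounts to c p = c together with b^* q = b^*. When p = q, the
   element c beta^* is invertible, with inverse b^* gamma, and carries b^*
   to c. *)
Require Import Defs.
From mathcomp Require Import all_boot all_order all_algebra.
From mathcomp Require Import complex.
From mathcomp Require Import all_classical all_reals topology normedtype.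

Import GRing.Theory.
Local Open Scope classical_set_scope.
Local Open Scope ring_scope.

Section Star.
Set Implicit Arguments.
Unset Strict Implicit.
Context {R : realType} {A : cstarAlgType R}.
Implicit Types x y z p q : A.

Lemma star1 : star 1 = 1 :> A.
Proof. by rewrite -[LHS]mulr1 -{2}(starK 1) -starM mulr1 starK. Qed.

Lemma star0 : star 0 = 0 :> A.
Proof. by apply: (@addrI _ (star 0)); rewrite -starD !addr0. Qed.

Lemma star_eq0 x : star x = 0 -> x = 0.
Proof. by move=> x0; rewrite -(starK x) x0 star0. Qed.

Lemma invertibles1 : invertibles A 1.
Proof. by exists 1; rewrite mulr1. Qed.

Lemma invertiblesM x y :
  invertibles A x -> invertibles A y -> invertibles A (x * y).
Proof.
move=> [x' [xx' x'x]] [y' [yy' y'y]]; exists (y' * x').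
by split; rewrite mulrA; [rewrite -(mulrA x) yy' | rewrite -(mulrA y') x'x];
  rewrite mulr1.
Qed.

Lemma invertibles_star x : invertibles A x -> invertibles A (star x).
Proof.
by move=> [y [xy yx]]; exists (star y); rewrite -!starM xy yx star1.
Qed.

Lemma rann_eq0_inj x : rann x = [set 0] -> injective ( *%R x).
Proof.
move=> x0 y z xyz; apply/eqP; rewrite -subr_eq0; apply/eqP.
suff: rann x (y - z) by rewrite x0.
by rewrite /rann /= mulrBr xyz subrr.
Qed.

Lemma linv_rann_eq0 x y : y * x = 1 -> rann x = [set 0].
Proof.
move=> yx; apply/seteqP; split=> z; rewrite /rann /=; last first.
  by move=> ->; rewrite mulr0.
by move=> xz; rewrite -(mul1r z) -yx -mulrA xz mulr0.
Qed.

Lemma rinv_mulset_l x y : x * y = 1 -> mulset_l x setT = setT.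
Proof.
move=> xy; apply/seteqP; split=> z // _.
by exists (y * z); rewrite // mulrA xy mul1r.
Qed.

Lemma mulset_l_rinv x : mulset_l x setT = setT -> exists y, x * y = 1.
Proof.
move=> xT; have : mulset_l x setT 1 by rewrite xT.
by case=> y _ xy; exists y.
Qed.

(** A right inverse of [x] becomes, under the adjoint, a left inverse of [star x], and left
    multiplication by [star x] can then be cancelled. *)
Lemma mulset_l_star_rann x :
  mulset_l x setT = setT -> rann (star x) = [set 0].
Proof.
case/mulset_l_rinv=> y xy.
by apply: (@linv_rann_eq0 _ (star y)); rewrite -starM xy star1.
Qed.

(** The closure condition on [S] covers both uses: it is trivial for [setT], and for [invertibles A]
    it asks that [z] be invertible. *)
Lemma mulset_l_sub x y z (S : set A) : x = y * z ->
  (forall t, S t -> S (z * t)) -> mulset_l x S `<=` mulset_l y S.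
Proof.
by move=> -> zS _ [t St <-]; exists (z * t); [exact: zS | rewrite mulrA].
Qed.

Lemma mulset_r_sub x y z (S : set A) : x = z * y ->
  (forall t, S t -> S (t * z)) -> mulset_r S x `<=` mulset_r S y.
Proof.
by move=> -> zS _ [t St <-]; exists (t * z); [exact: zS | rewrite mulrA].
Qed.

Lemma rann_sub x y z : x = z * y -> rann y `<=` rann x.
Proof. by move=> -> t; rewrite /rann /= -mulrA => ->; rewrite mulr0. Qed.

Lemma lann_sub x y z : x = y * z -> lann y `<=` lann x.
Proof. by move=> -> t; rewrite /lann /= mulrA => ->; rewrite mul0r. Qed.

(** Serves to bring condition (v) back to the inclusions of condition (iii). *)
Lemma lann_star_sub x y :
  lann x `<=` lann y -> rann (star x) `<=` rann (star y).
Proof.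
move=> xy t; rewrite /rann /= => xt; rewrite -(starK t) -starM.
rewrite (_ : star t * y = 0) ?star0 //; apply: xy; rewrite /lann /=.
by apply: star_eq0; rewrite starM starK.
Qed.

(** The element [1 - p] is annihilated by [x], hence by [y]. *)
Lemma rann_sub_fix x y p : x * p = x -> rann x `<=` rann y -> y * p = y.
Proof.
move=> xp xy; apply/eqP; rewrite eq_sym -subr_eq0 -{1}(mulr1 y) -mulrBr.
by apply/eqP; apply: xy; rewrite /rann /= mulrBr mulr1 xp subrr.
Qed.

Lemma inj_factor_fix x y z q :
  rann z = [set 0] -> x = z * y -> x * q = x -> y * q = y.
Proof.
by move=> z0 xE xq; apply: (rann_eq0_inj z0); rewrite mulrA -xE.
Qed.

Lemma factor_fix x y z p : x = z * y -> y * p = y -> x * p = x.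
Proof. by move=> -> yp; rewrite -mulrA yp. Qed.

End Star.

Section FullRankFactorization.
Set Implicit Arguments.
Unset Strict Implicit.
Context {R : realType} {A : cstarAlgType R}.
Implicit Types a b c x : A.

Lemma mp_factor_unit a b c x : is_mp_inverse a x -> a = b * c ->
  rann b = [set 0] -> mulset_l c setT = setT -> c * x * b = 1.
Proof.
move=> [axa _ _ _] abc b0 /mulset_l_rinv[d cd]; apply: (rann_eq0_inj b0).
transitivity (a * x * a * d); last by rewrite -axa abc -mulrA cd.
by rewrite abc !mulrA -(mulrA _ c d) cd !mulr1.
Qed.

(** Uniqueness identifies the chosen [mp_inverse a] with the given [x]. *)
Lemma EP_commute a x : is_mp_inverse a x -> EP a <-> a * x = x * a.
Proof.
move=> ax; have -> : x = mp_inverse a.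
  apply: (is_mp_inverse_unique ax).
  exact: (@xgetPex _ 0 [set x | is_mp_inverse a x] (ex_intro _ x ax)).
by split=> [[]|axC] //; split=> //; exists x.
Qed.

End FullRankFactorization.

Theorem theorem3p9 (R : realType) (A : cstarAlgType R) (a b c : A)
    (a_mp : mp_invertible a) (a_bc : a = b * c)
    (b_inj : rann b = [set 0]) (c_surj : mulset_l c setT = setT) :
  [<-> (* i *)    EP a;
       (* ii *)   (mulset_l (star c) setT `&` mulset_r setT (star b)) a;
       (* iii *)  rann (star b) = rann c;
       (* iv *)   mulset_l b setT = mulset_l (star c) setT;
       (* v *)    lann b = lann (star c);
       (* vi *)   mulset_r setT c = mulset_r setT (star b);
       (* vii *)  mulset_l b (invertibles A) =
                  mulset_l (star c) (invertibles A);
       (* viii *) mulset_r (invertibles A) c =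
                  mulset_r (invertibles A) (star b);
       (* ix *)   exists2 x : A, invertibles A x & c = x * star b;
       (* x *)    exists2 y : A, rann y = [set 0] & c = y * star b;
       (* xi *)   exists z1 z2 : A, c = z1 * star b /\ star b = z2 * c;
       (* xii *)  exists2 v : A, mulset_l v setT = setT & b = star c * v;
       (* xiii *) exists2 s1 : A, rann s1 = [set 0] & star b = s1 * c;
       (* xiv *)  exists2 s2 : A, mulset_l s2 setT = setT & star c = b * s2].
Proof.
have [x ax] := a_mp; have u1 := mp_factor_unit ax a_bc b_inj c_surj.
have [_ _ sp sq] := ax.
pose p := a * x; pose q := x * a.
have bp : star b * p = star b.
  by rewrite /p -sp -starM a_bc -!mulrA (mulrA c) u1 mulr1.
have cq : c * q = c by rewrite /q a_bc !mulrA u1 mul1r.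
have pb : p = star (c * x) * star b by rewrite -starM mulrA -a_bc sp.
have qc : q = x * b * c by rewrite -mulrA -a_bc.
have starE (y z w : A) : y = z * w -> star y = star w * star z.
  by move=> ->; rewrite starM.
(* As [q] is a left multiple of [c] and [p] one of [star b], the hypotheses give [q * p = q] and
   [p * q = p]; the adjoint of the latter is [q * p = p]. *)
have fixEP : c * p = c -> star b * q = star b -> EP a.
  move=> cp bq; apply/(EP_commute ax); rewrite -/p -/q.
  have qp : q * p = q by rewrite {1}qc -mulrA cp -qc.
  have pq : p * q = p by rewrite {1}pb -mulrA bq -pb.
  by rewrite -qp -[LHS]sp -/p -{1}pq starM sp sq.
have EP_inv : EP a -> exists w : A, exists2 u : A,
    w * u = 1 /\ u * w = 1 & c = w * star b /\ star b = u * c.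
  move=> /(EP_commute ax); rewrite -/p -/q => pq.
  have cE : c = c * star (c * x) * star b by rewrite -mulrA -pb pq cq.
  have bE : star b = star b * (x * b) * c by rewrite -mulrA -qc -pq bp.
  (* By [cE] and [bE], the two products collapse to [c * x * b] and its adjoint. *)
  exists (c * star (c * x)), (star b * (x * b)) => //; split.
    by rewrite mulrA -cE mulrA.
  by rewrite mulrA -bE -starM u1 star1.
have ix_of : EP a -> exists2 y : A, invertibles A y & c = y * star b.
  by case/EP_inv=> w [u [wu uw] [cE _]]; exists w => //; exists u.
have xi_of : EP a -> exists z1 z2 : A, c = z1 * star b /\ star b = z2 * c.
  by case/EP_inv=> w [u _ [cE bE]]; exists w, u.
have of_xi z1 z2 : c = z1 * star b -> star b = z2 * c -> EP a.
  by move=> cE bE; apply: fixEP;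
    [exact: factor_fix cE bp | exact: factor_fix bE cq].
(* The factorization transfers [p] from [star b] to [c]; cancelling [y] transfers [q] back from [c]
   to [star b]. *)
have of_x y : rann y = [set 0] -> c = y * star b -> EP a.
  move=> y0 cE; apply: fixEP; first exact: factor_fix cE bp.
  exact: inj_factor_fix y0 cE cq.
have of_xiii s : rann s = [set 0] -> star b = s * c -> EP a.
  move=> s0 bE; apply: fixEP; last exact: factor_fix bE cq.
  exact: inj_factor_fix s0 bE bp.
have invT (y : A) : invertibles A y -> mulset_l y setT = setT.
  by case=> z [yz _]; exact: rinv_mulset_l yz.
have inv0 (y : A) : invertibles A y -> rann y = [set 0].
  by case=> z [_ zy]; exact: linv_rann_eq0 zy.
(* Adjoints turn (xii) into (xiii), and likewise (xiv) into (x). *)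
have of_xii v : mulset_l v setT = setT -> b = star c * v -> EP a.
  move=> vT /starE; rewrite starK; apply: of_xiii.
  exact: mulset_l_star_rann.
have of_xiv s : mulset_l s setT = setT -> star c = b * s -> EP a.
  move=> sT /starE; rewrite starK; apply: of_x.
  exact: mulset_l_star_rann.
(* The implications form a cycle in the listed order. Apart from (viii) to (ix) and (ix) to (x),
   those between (ii) and (xiv) first recover [EP a] and then read off the next condition. *)
tfae.
- case/xi_of=> w [u [cE bE]]; split.
    by exists (star u * c) => //; rewrite mulrA -[_ * star u]starM -bE starK.
  by exists (b * w) => //; rewrite -mulrA -cE.
- case=> -[y _ ay] [z _ az].
  suff /xi_of[w [u [cE bE]]] : EP a.
    by apply/seteqP; split; [exact: rann_sub cE | exact: rann_sub bE].
  have ap : a * p = a by rewrite -az -mulrA bp.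
  have qa : q * a = a by rewrite -ay mulrA -[q]sq -starM cq.
  (* Since [c * x * b = 1], one has [c = c * x * a] and [b = a * x * b], so [a * p = a] passes to
     [c] and [q * a = a] to [b]. *)
  apply: fixEP.
    by rewrite -[c in LHS]mul1r -u1 -!mulrA (mulrA b) -a_bc ap a_bc !mulrA u1
      mul1r.
  rewrite -[q]sq -starM; congr star.
  by rewrite -[b in LHS]mulr1 -u1 !mulrA -(mulrA _ b) -a_bc qa a_bc -!mulrA
    (mulrA c) u1 mulr1.
- move=> bc; suff /xi_of[w [u [/starE cE /starE bE]]] : EP a.
    rewrite !starK in cE bE.
    by apply/seteqP; split;
      [apply: mulset_l_sub bE _ | apply: mulset_l_sub cE _].
  by apply: fixEP; [apply: (rann_sub_fix bp) | apply: (rann_sub_fix cq)];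
    rewrite bc.
- move=> bc; suff /xi_of[w [u [/starE cE /starE bE]]] : EP a.
    rewrite !starK in cE bE.
    by apply/seteqP; split; [exact: lann_sub cE | exact: lann_sub bE].
  have [z _ /esym/starE bE] : mulset_l (star c) setT b.
    by rewrite -bc; exists 1; rewrite ?mulr1.
  have [y _ /esym/starE cE] : mulset_l b setT (star c).
    by rewrite bc; exists 1; rewrite ?mulr1.
  by rewrite !starK in bE cE; exact: of_xi cE bE.
- move=> bc; suff /xi_of[w [u [cE bE]]] : EP a.
    by apply/seteqP; split;
      [apply: mulset_r_sub cE _ | apply: mulset_r_sub bE _].
  by apply: fixEP; [apply: (rann_sub_fix bp) | apply: (rann_sub_fix cq)];
    rewrite -{1}(starK c); apply: lann_star_sub; rewrite bc.
- move=> bc; suff /EP_inv[w [u [wu uw] [/starE cE /starE bE]]] : EP a.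
    rewrite !starK in cE bE.
    by apply/seteqP; split;
      [apply: mulset_l_sub bE _ | apply: mulset_l_sub cE _];
      move=> t; apply: invertiblesM; apply: invertibles_star;
      [exists w | exists u].
  have [z _ cE] : mulset_r setT (star b) c.
    by rewrite -bc; exists 1; rewrite ?mul1r.
  have [y _ bE] : mulset_r setT c (star b).
    by rewrite bc; exists 1; rewrite ?mul1r.
  exact: of_xi (esym cE) (esym bE).
- move=> bc; suff /EP_inv[w [u [wu uw] [cE bE]]] : EP a.
    by apply/seteqP; split;
      [apply: mulset_r_sub cE _ | apply: mulset_r_sub bE _];
      move=> t /invertiblesM; apply; [exists u | exists w].
  have [v v_inv bE] : mulset_l (star c) (invertibles A) b.
    by rewrite -bc; exists 1; rewrite ?mulr1 //; exact: invertibles1.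
  exact: of_xii (invT _ v_inv) (esym bE).
- move=> bc.
  have [y y_inv yE] : mulset_r (invertibles A) (star b) c.
    by rewrite -bc; exists 1; rewrite ?mul1r //; exact: invertibles1.
  by exists y.
- by case=> y /inv0 y0 cE; exists y.
- by case=> y y0 /(of_x _ y0)/xi_of.
- case=> z1 [z2 [cE bE]].
  (* The witness for (xii) is the adjoint of the invertible [u] with [star b = u * c]. *)
  have [w [u [wu uw] [_ /starE]]] := EP_inv (of_xi _ _ cE bE).
  rewrite starK => bE'; exists (star u) => //.
  by apply: invT; apply: invertibles_star; exists w.
- case=> v vT /(of_xii _ vT)/EP_inv[w [u [wu uw] [_ bE]]].
  by exists u => //; apply: inv0; exists w.
- case=> s s0 /(of_xiii _ s0)/ix_of[w w_inv /starE].
  rewrite starK => cE; exists (star w) => //.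
  by apply: invT; apply: invertibles_star.
- by case=> s sT; exact: of_xiv.
Qed.
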